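(* Let $\alpha\in[0,1]$, $\rho>0$, and take $a_0(n)=\dfrac{\rho+1}{\rho}$, $a_1(n)=-\dfrac{\rho+2}{\rho}$ for all $n$. Then there is a positive constant $C$, independent of $n$, $x$ and $f$, such that for every $f\in C^2[0,1]$, every $x\in[0,1]$ and every $n\ge2$, $$\left|J_{n,\alpha,\rho}^{M,1}(f;x)-f(x)-\frac12 J_{n,\alpha,\rho}^{M,1}\bigl((t-x)^2;x\bigr)f''(x)\right|\le C\,\frac1n\,\omega\!\left(f'';\frac{1}{\sqrt n}\right).$$
   Context: Fix $\alpha\in[0,1]$ and $\rho>0$. For $x\in[0,1]$ let $p_{1,0,\alpha}(x)=1-x$, $p_{1,1,\alpha}(x)=x$, and for $m\ge 2$, $0\le k\le m$, $$p_{m,k,\alpha}(x)=\left[\binom{m-2}{k}(1-\alpha)x+\binom{m-2}{k-2}(1-\alpha)(1-x)+\binom{m}{k}\alpha x(1-x)\right]x^{k-1}(1-x)^{m-k-1}$$ (understood as a polynomial in $x$, with $\binom{r}{s}=0$ if $s<0$ or $s>r$); $p_{m,k,\alpha}=0$ if $k<0$ or $k>m$. Let $$\mu_{n,k}^\rho(t)=\frac{t^{k\rho}(1-t)^{(n-k)\rho}}{B(k\rho+1,(n-k)\rho+1)},\quad t\in[0,1],$$ where $B$ is the Beta function. Given real sequences $a_0(n),a_1(n)$, put $a(x,n)=a_1(n)x+a_0(n)$ and, for $n\ge2$, $$J_{n,\alpha,\rho}^{M,1}(f;x)=\sum_{k=0}^n\bigl[a(x,n)\,p_{n-1,k,\alpha}(x)+a(1-x,n)\,p_{n-1,k-1,\alpha}(x)\bigr]\int_0^1\mu_{n,k}^\rho(t)f(t)\,dt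 .$$ $J_{n,\alpha,\rho}^{M,1}((t-x)^2;x)$ denotes the operator applied to $t\mapsto(t-x)^2$, evaluated at $x$. For a bounded function $g$ on $[0,1]$ and $\delta>0$, $\omega(g;\delta)=\sup\{|g(y)-g(z)|: y,z\in[0,1],\ |y-z|\le\delta\}$. *)

(* Defs.v *)
From HB Require Import structures.
From mathcomp Require Import all_boot all_order all_algebra.
From mathcomp Require Import all_classical all_reals all_analysis.
From mathcomp Require Import ring.

Set Implicit Arguments.
Unset Strict Implicit.
Unset Printing Implicit Defensive.

Import Order.TTheory GRing.Theory Num.Theory.
Import numFieldNormedType.Exports.

Local Open Scope classical_set_scope.
Local Open Scope ring_scope.

(* For m >= 2 the basis is the polynomial
     [ C(m-2,k) (1-alpha) x + C(m-2,k-2) (1-alpha) (1-x) + C(m,k) alpha x (1-x) ]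
       * x^(k-1) * (1-x)^(m-k-1),
   in which x^(k-1) or (1-x)^(m-k-1) may have exponent -1, to be cancelled
   against the bracket. The product is distributed over the bracket, so that
   every term with a nonzero binomial coefficient has natural exponents; see
   alpha_bernsteinE. The test on k encodes C(m-2,k-2) = 0 for k < 2. *)
Definition alpha_bernstein (R : realType) (alpha : R) (m k : nat) (x : R) : R :=
  match m with
  | 0%N => 0
  | 1%N => match k with 0%N => 1 - x | 1%N => x | _ => 0 end
  | _ =>
      'C(m - 2, k)%:R * (1 - alpha) * x ^+ k * (1 - x) ^+ (m - k - 1)
    + (if (2 <= k)%N then 'C(m - 2, k - 2)%:R else 0)
        * (1 - alpha) * x ^+ (k - 1) * (1 - x) ^+ (m - k)
    + 'C(m, k)%:R * alpha * x ^+ k * (1 - x) ^+ (m - k)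
  end.

Lemma alpha_bernsteinE (R : realType) (alpha : R) (m k : nat) (x : R) :
  (2 <= m)%N -> (k <= m)%N -> x != 0 -> 1 - x != 0 ->
  alpha_bernstein alpha m k x =
  ('C(m - 2, k)%:R * (1 - alpha) * x
   + (if (2 <= k)%N then 'C(m - 2, k - 2)%:R else 0) * (1 - alpha) * (1 - x)
   + 'C(m, k)%:R * alpha * x * (1 - x))
  * x ^ (k%:Z - 1) * (1 - x) ^ (m%:Z - k%:Z - 1).
Proof.
case: m => [|[|m]] // _ km x0 x1; rewrite /alpha_bernstein.
have -> : x ^ (k%:Z - 1) = x ^+ k / x by rewrite expfzDr // exprN1.
have -> : (1 - x) ^ (m.+2%:Z - k%:Z - 1) = (1 - x) ^+ (m.+2 - k) / (1 - x).
  by rewrite expfzDr // exprN1 subzn.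
rewrite !mulrDl; congr (_ + _ + _); last by field; apply/andP.
- have [mk|mk] := ltnP (m.+2 - 2) k; first by rewrite bin_small // !mul0r.
  have -> : (m.+2 - k = (m.+2 - k - 1).+1)%N.
    by rewrite subn1 prednK // subn_gt0 ltnS (leq_trans mk) // !subSS subn0.
  by rewrite subn1 /= exprS; field; apply/andP.
- case: k km => [|[|k]] km //=; rewrite ?mul0r //.
  by rewrite subn1 /= [x ^+ k.+2]exprS; field; apply/andP.
Qed.

Lemma alpha_bernstein_gt (R : realType) (alpha : R) (m k : nat) (x : R) :
  (m < k)%N -> alpha_bernstein alpha m k x = 0.
Proof.
case: m => [|[|m]] //; first by case: k => [|[|k]].
move=> mk; rewrite /alpha_bernstein !bin_small //.
- by rewrite if_same !mul0r !addr0.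
- by rewrite ltn_sub2r // (leq_trans _ mk).
- by rewrite (leq_ltn_trans _ mk) // leq_subr.
Qed.

Definition Beta (R : realType) (a b : R) : R :=
  \int[lebesgue_measure]_(t in `[0, 1]) (t `^ (a - 1) * (1 - t) `^ (b - 1)).

Definition paltanea_density (R : realType) (rho : R) (n k : nat) (t : R) : R :=
  t `^ (k%:R * rho) * (1 - t) `^ ((n - k)%:R * rho)
  / Beta (k%:R * rho + 1) ((n - k)%:R * rho + 1).

Definition lin_coef (R : realType) (a0 a1 : nat -> R) (x : R) (n : nat) : R :=
  a1 n * x + a0 n.

(* The inner match is p_{n-1,k-1}, which is 0 at k = 0. *)
Definition JM1 (R : realType) (alpha rho : R) (a0 a1 : nat -> R) (n : nat)
    (f : R -> R) (x : R) : R :=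
  \sum_(k < n.+1)
    (lin_coef a0 a1 x n * alpha_bernstein alpha (n - 1) k x
     + lin_coef a0 a1 (1 - x) n
       * (match nat_of_ord k with
          | 0%N => 0
          | j.+1 => alpha_bernstein alpha (n - 1) j x
          end))
    * \int[lebesgue_measure]_(t in `[0, 1]) (paltanea_density rho n k t * f t).

(* Derivatives on [0, 1] are taken relative to [0, 1], hence one-sided at the
   endpoints; values of f outside [0, 1] are irrelevant. *)
Definition diff_quot (R : realType) (f : R -> R) (x y : R) : R :=
  (f y - f x) / (y - x).

Definition derivable01 (R : realType) (f : R -> R) (x : R) : Prop :=
  cvg (diff_quot f x y @[y --> within `[0, 1] x^']).

Definition deriv01 (R : realType) (f : R -> R) (x : R) : R :=
  lim (diff_quot f x y @[y --> within `[0, 1] x^']).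

Definition C2_01 (R : realType) (f : R -> R) : Prop :=
  [/\ forall x : R, x \in `[0, 1] -> derivable01 f x,
      forall x : R, x \in `[0, 1] -> derivable01 (deriv01 f) x
    & {within `[0, 1], continuous (deriv01 (deriv01 f))}].

Definition modulus01 (R : realType) (g : R -> R) (delta : R) : R :=
  sup [set r : R | exists y z : R,
    [/\ y \in `[0, 1], z \in `[0, 1], `|y - z| <= delta & r = `|g y - g z|]].

(* Main.v *)
Require Import Defs.
From HB Require Import structures.
From mathcomp Require Import all_boot all_order all_algebra.
From mathcomp Require Import all_classical all_reals all_analysis.
From mathcomp Require Import ring lra.

(** With m = n - 1 and s = n rho + 2, the operator is
      J f = a(x) P[E_k f] + a(1 - x) P[E_(k+1) f],
    where P averages functions of k with the alpha-Bernstein weights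
    p_(m,k,alpha)(x), and E_k averages functions of t with the beta density of
    parameters (k rho + 1, (n - k) rho + 1).  The coefficients a(x), a(1 - x)
    may be negative, but they are bounded by (rho + 2) / rho and add up to 1.
    Since P[k] = m x and E_k[t] = (k rho + 1) / s, the given a_0 and a_1 are
    such that J reproduces affine functions.  Hence the quantity to be bounded
    is exactly J r, where r is the second order Taylor remainder of f at x
    (combine_remainders, JM1_voronovskaya_le).

    By the mean value theorem applied twice (taylor2), and since
    |g y - g z| <= (1 + |y - z| / d) w(g; d) for every modulus of continuity
    (modulus01_lin), taking d = 1 / sqrt n gives
      |r t| <= w(f''; 1 / sqrt n) (2 / n + 2 n (t - x)^4)
    (taylor_remainder_le).  So everything rests on one estimate: the positive
    operators P[E_k .] and P[E_(k+1) .] send (t - x)^4 to O(1 / n^2), uniformly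
    in x (composed_moment4_le).  Up to a bounded term, s (t - x) splits into
    s (t - E_k[t]), the fluctuation of the beta law, and rho (k - m x), the
    fluctuation of the weights.  The fourth central moment of the beta law is
    O(1 / s^2): integrating the derivative of t^a (1 - t)^b g(t) over [0, 1]
    gives a Stein identity (beta_stein) that lowers the order of a central
    moment by two at the cost of a factor O(1 / s).  The fourth central moment
    of the weights is O(m^2): for m >= 2 they are mixtures of binomial laws of
    sizes m - 2 and m, shifted by at most 2 (alpha_bernstein_meanE), and
    binomial moments obey the one-step recursion of a sum of Bernoulli
    variables (bernstein_meanS). *)

Set Implicit Arguments.
Unset Strict Implicit.
Unset Printing Implicit Defensive.

Import Order.TTheory GRing.Theory Num.Theory.
Import numFieldNormedType.Exports.

Local Open Scope classical_set_scope.
Local Open Scope ring_scope.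

Lemma exprD4_le (R : realDomainType) (u v : R) :
  (u + v) ^+ 4 <= 8 * (u ^+ 4 + v ^+ 4).
Proof.
have : 0 <= (u - v) ^+ 2 * (u + v) ^+ 2 by rewrite mulr_ge0 ?sqr_ge0.
have := sqr_ge0 ((u - v) ^+ 2); have := sqr_ge0 (u ^+ 2 - v ^+ 2); nra.
Qed.

(** * Moments of the Bernstein weights *)

Section BernsteinMean.
Context {R : realType}.
Implicit Types (m : nat) (x c : R) (g h : nat -> R).

Definition bernstein_mean m x h : R :=
  \sum_(k < m.+1) 'C(m, k)%:R * x ^+ k * (1 - x) ^+ (m - k) * h k.

Lemma eq_bernstein_mean m x g h : g =1 h ->
  bernstein_mean m x g = bernstein_mean m x h.
Proof. by move=> gh; apply: eq_bigr => k _; rewrite gh. Qed.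

Lemma bernstein_meanD m x g h : bernstein_mean m x (fun k => g k + h k) =
  bernstein_mean m x g + bernstein_mean m x h.
Proof. by rewrite -big_split; apply: eq_bigr => k _; rewrite mulrDr. Qed.

Lemma bernstein_meanZ m x c h : bernstein_mean m x (fun k => c * h k) =
  c * bernstein_mean m x h.
Proof. by rewrite mulr_sumr; apply: eq_bigr => k _; ring. Qed.

Lemma bernstein_mean_le m x g h : 0 <= x <= 1 -> (forall k, g k <= h k) ->
  bernstein_mean m x g <= bernstein_mean m x h.
Proof.
move=> /andP[x0 x1] gh; apply: ler_sum => k _; apply: ler_wpM2l (gh _).
by rewrite !mulr_ge0 ?exprn_ge0 // subr_ge0.
Qed.

(** Condition on one of the m + 1 Bernoulli variables of parameter x whose sum
    has the binomial law: it adds 1 to the sum of the others with probability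
    x.  All the binomial moments below follow from this by induction on m. *)
Lemma bernstein_meanS m x h : bernstein_mean m.+1 x h =
  bernstein_mean m x (fun k => (1 - x) * h k + x * h k.+1).
Proof.
rewrite bernstein_meanD !bernstein_meanZ /bernstein_mean !mulr_sumr.
have -> : \sum_(k < m.+1)
    (1 - x) * ('C(m, k)%:R * x ^+ k * (1 - x) ^+ (m - k) * h k) =
  \sum_(k < m.+2) 'C(m, k)%:R * x ^+ k * (1 - x) ^+ (m.+1 - k) * h k.
  rewrite [RHS]big_ord_recr /= bin_small // !mul0r addr0.
  by apply: eq_bigr => k _; rewrite subSn ?leq_ord // exprS; ring.
rewrite [in RHS]big_ord_recl [LHS]big_ord_recl /= !bin0 -addrA; congr (_ + _).
rewrite -big_split /=; apply: eq_bigr => k _.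
by rewrite /bump /= add1n binS natrD subSS exprS; ring.
Qed.

Lemma bernstein_mean1 m x : bernstein_mean m x (fun=> 1) = 1.
Proof.
elim: m => [|m IH]; first by rewrite /bernstein_mean big_ord1 bin0 !mulr1.
rewrite bernstein_meanS -[RHS]IH; apply: eq_bernstein_mean => k; ring.
Qed.

Lemma bernstein_mean_cst m x c : bernstein_mean m x (fun=> c) = c.
Proof.
transitivity (bernstein_mean m x (fun=> c * 1)); last first.
  by rewrite bernstein_meanZ bernstein_mean1 mulr1.
by apply: eq_bernstein_mean => k; rewrite mulr1.
Qed.

Lemma bernstein_mean_id m x : bernstein_mean m x (fun k => k%:R) = m%:R * x.
Proof.
elim: m => [|m IH]; first by rewrite /bernstein_mean big_ord1 mulr0 mul0r.
rewrite bernstein_meanS.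
rewrite (@eq_bernstein_mean _ _ _ (fun k => k%:R + x)); last first.
  by move=> k; rewrite -natr1; ring.
by rewrite bernstein_meanD bernstein_mean_cst IH -natr1; ring.
Qed.

Lemma bernstein_variance m x :
  bernstein_mean m x (fun k => (k%:R - m%:R * x) ^+ 2) = m%:R * (x * (1 - x)).
Proof.
elim: m => [|m IH]; first by rewrite /bernstein_mean big_ord1 /=; ring.
rewrite bernstein_meanS (@eq_bernstein_mean _ _ _
  (fun k => (k%:R - m%:R * x) ^+ 2 + x * (1 - x))); last first.
  by move=> k; rewrite -!natr1; ring.
by rewrite bernstein_meanD bernstein_mean_cst IH -natr1; ring.
Qed.

(** Adding a centered Bernoulli variable to a centered sum changes the fourth
    moment by 6 v times the variance plus a bounded term, v = x (1 - x), so the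
    growth is quadratic in m. *)
Lemma bernstein_moment4_le m x : 0 <= x <= 1 ->
  bernstein_mean m x (fun k => (k%:R - m%:R * x) ^+ 4) <= 3 * m%:R ^+ 2.
Proof.
move=> x01; have /andP[x0 x1] := x01.
set v := x * (1 - x).
have v0 : 0 <= v by rewrite mulr_ge0 // subr_ge0.
have v1 : v <= 1 / 4 by rewrite /v; have := sqr_ge0 (x - 1 / 2); nra.
elim: m => [|m IH].
  by rewrite /bernstein_mean big_ord1 /= mul0r subr0 !expr0n /= !mulr0.
rewrite bernstein_meanS (@eq_bernstein_mean _ _ _
  (fun k => (k%:R - m%:R * x) ^+ 4 + (6 * v * (k%:R - m%:R * x) ^+ 2
    + (4 * v * (1 - 2 * x) * (k%:R + - (m%:R * x))
       + v * (1 - 3 * v))))); last first.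
  by move=> k; rewrite -!natr1 /v; ring.
rewrite !bernstein_meanD !bernstein_meanZ bernstein_meanD.
rewrite bernstein_variance -/v.
rewrite !bernstein_mean_cst bernstein_mean_id subrr mulr0 add0r -[m.+1%:R]natr1.
have m0 : 0 <= m%:R :> R by [].
have v2 : v ^+ 2 <= 1 by nra.
have mv : m%:R * v ^+ 2 <= m%:R by rewrite ler_piMr.
rewrite (_ : 6 * v * _ = 6 * (m%:R * v ^+ 2)); last by ring.
nra.
Qed.

End BernsteinMean.

(** * Moments of the alpha-Bernstein weights *)

Section AlphaBernsteinMean.
Context {R : realType}.
Implicit Types (alpha x c : R) (m : nat) (g h : nat -> R).

Definition alpha_bernstein_mean alpha m x h : R :=
  \sum_(k < m.+1) alpha_bernstein alpha m k x * h k.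

(** The weights of index m + 2 mix, in proportions 1 - alpha and alpha, the law
    of S + 2 T, with S binomial of size m and T an independent Bernoulli
    variable of parameter x, and the binomial law of size m + 2. *)
Lemma alpha_bernstein_meanE alpha m x h :
  alpha_bernstein_mean alpha m.+2 x h =
  (1 - alpha) * bernstein_mean m x (fun k => (1 - x) * h k + x * h k.+2)
  + alpha * bernstein_mean m.+2 x h.
Proof.
rewrite bernstein_meanD !bernstein_meanZ /alpha_bernstein_mean.
rewrite /alpha_bernstein !subSS subn0.
under eq_bigr do rewrite !mulrDl.
rewrite !big_split /= mulrDr; congr (_ + _ + _).
- rewrite 2!big_ord_recr /= !(@bin_small m) //.
  rewrite !mul0r !addr0 !mulr_sumr.
  apply: eq_bigr => k _; rewrite (_ : (m.+2 - k - 1 = (m - k).+1)%N).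
    by rewrite exprS; ring.
  by rewrite -subnDA addn1 !subSS subSn ?leq_ord.
- rewrite 2!big_ord_recl /= !mul0r !add0r !mulr_sumr.
  apply: eq_bigr => k _; rewrite /bump /= !add1n !subSS !subn0 exprS; ring.
- by rewrite mulr_sumr; apply: eq_bigr => k _; ring.
Qed.

Lemma eq_alpha_bernstein_mean alpha m x g h : g =1 h ->
  alpha_bernstein_mean alpha m x g = alpha_bernstein_mean alpha m x h.
Proof. by move=> gh; apply: eq_bigr => k _; rewrite gh. Qed.

Lemma alpha_bernstein_meanD alpha m x g h :
  alpha_bernstein_mean alpha m x (fun k => g k + h k) =
  alpha_bernstein_mean alpha m x g + alpha_bernstein_mean alpha m x h.
Proof. by rewrite -big_split; apply: eq_bigr => k _; rewrite mulrDr. Qed.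

Lemma alpha_bernstein_meanZ alpha m x c h :
  alpha_bernstein_mean alpha m x (fun k => c * h k) =
  c * alpha_bernstein_mean alpha m x h.
Proof. by rewrite mulr_sumr; apply: eq_bigr => k _; rewrite mulrCA. Qed.

Lemma alpha_bernstein_ge0 alpha m k x : 0 <= alpha <= 1 -> 0 <= x <= 1 ->
  0 <= alpha_bernstein alpha m k x.
Proof.
move=> /andP[a0 a1] /andP[x0 x1]; have x'0 : 0 <= 1 - x by rewrite subr_ge0.
have a'0 : 0 <= 1 - alpha by rewrite subr_ge0.
case: m => [|[|m]] /=; [by []|by case: k => [|[|k]]|].
by rewrite !addr_ge0 // !mulr_ge0 ?exprn_ge0 //; case: ifP.
Qed.

Lemma alpha_bernstein_mean_le alpha m x g h :
  0 <= alpha <= 1 -> 0 <= x <= 1 -> (forall k, (k <= m)%N -> g k <= h k) ->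
  alpha_bernstein_mean alpha m x g <= alpha_bernstein_mean alpha m x h.
Proof.
move=> a01 x01 gh; apply: ler_sum => k _.
by rewrite ler_wpM2l ?gh ?leq_ord // alpha_bernstein_ge0.
Qed.

Lemma ler_norm_alpha_bernstein_mean alpha m x h :
  0 <= alpha <= 1 -> 0 <= x <= 1 ->
  `|alpha_bernstein_mean alpha m x h| <=
  alpha_bernstein_mean alpha m x (fun k => `|h k|).
Proof.
move=> a01 x01; apply: le_trans (ler_norm_sum _ _ _) _; apply: ler_sum => k _.
by rewrite normrM ger0_norm ?alpha_bernstein_ge0.
Qed.

Lemma alpha_bernstein_mean_cst alpha m x c : (0 < m)%N ->
  alpha_bernstein_mean alpha m x (fun=> c) = c.
Proof.
case: m => [|[|m]] // _.
  by rewrite /alpha_bernstein_mean !big_ord_recr big_ord0 /=; ring.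
by rewrite alpha_bernstein_meanE !bernstein_mean_cst; ring.
Qed.

Lemma alpha_bernstein_mean_id alpha m x : (0 < m)%N ->
  alpha_bernstein_mean alpha m x (fun k => k%:R) = m%:R * x.
Proof.
case: m => [|[|m]] // _.
  by rewrite /alpha_bernstein_mean !big_ord_recr big_ord0 /=; ring.
rewrite alpha_bernstein_meanE (@eq_bernstein_mean _ _ _ _
  (fun k => k%:R + 2 * x)); last by move=> k; rewrite -!natr1; ring.
rewrite bernstein_meanD !bernstein_mean_id bernstein_mean_cst -!natr1; ring.
Qed.

(** The shifts by 2 (1 - x) or - 2 x relative to the centered binomial law of
    size m - 2 contribute at most 8 * 2 ^ 4 = 128 to the fourth moment, which
    is at most 32 m ^ 2 as soon as m >= 2. *)
Lemma alpha_bernstein_moment4_le alpha m x :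
  0 <= alpha <= 1 -> 0 <= x <= 1 -> (0 < m)%N ->
  alpha_bernstein_mean alpha m x (fun k => (k%:R - m%:R * x) ^+ 4) <=
  152 * m%:R ^+ 2.
Proof.
move=> /andP[a0 a1] x01 m0; have /andP[x0 x1] := x01.
have h4 (d : R) : 0 <= d <= 2 -> d ^+ 4 <= 16.
  move=> /andP[d0 d2]; rewrite (_ : 16 = 2 ^+ 4); last by ring.
  by rewrite lerXn2r ?nnegrE.
case: m m0 => [|[|m]] // _.
  rewrite /alpha_bernstein_mean !big_ord_recr big_ord0 /= add0r mul1r sub0r.
  have y0 : 0 <= 1 - x by rewrite subr_ge0.
  have : (- x) ^+ 4 <= 16.
    by rewrite exprNn -signr_odd /= expr0 mul1r h4 //; lra.
  have : (1 - x) ^+ 4 <= 16 by rewrite h4 //; lra.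
  nra.
rewrite alpha_bernstein_meanE.
set M : R := m.+2%:R.
have M2 : 2 <= M by rewrite ler_nat.
set A := bernstein_mean _ _ _; set B := bernstein_mean _ _ _.
suff [hA hB] : A <= 152 * M ^+ 2 /\ B <= 152 * M ^+ 2 by nra.
split; last first.
  by apply: le_trans (bernstein_moment4_le _ x01) _; rewrite -/M; nra.
apply: (@le_trans _ _ (bernstein_mean m x
    (fun k => 8 * (k%:R - m%:R * x) ^+ 4 + 128))).
  apply: bernstein_mean_le => // k.
  have -> : k.+2%:R - M * x = (k%:R - m%:R * x) + 2 * (1 - x).
    by rewrite /M -!natr1; ring.
  have -> : k%:R - M * x = (k%:R - m%:R * x) - 2 * x.
    by rewrite /M -!natr1; ring.
  set d := k%:R - _.
  have := exprD4_le d (- (2 * x)); have := exprD4_le d (2 * (1 - x)).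
  have : (- (2 * x)) ^+ 4 <= 16.
    by rewrite exprNn -signr_odd /= expr0 mul1r h4 //; lra.
  have : (2 * (1 - x)) ^+ 4 <= 16 by rewrite h4 //; lra.
  set p := (2 * (1 - x)) ^+ 4; set q := (- (2 * x)) ^+ 4.
  set P := (d + 2 * (1 - x)) ^+ 4; set Q := (d - 2 * x) ^+ 4; set D := d ^+ 4.
  by nra.
rewrite bernstein_meanD bernstein_meanZ bernstein_mean_cst.
have := bernstein_moment4_le m x01.
have -> : m%:R = M - 2 by rewrite /M -!natr1; ring.
nra.
Qed.

End AlphaBernsteinMean.

(** * Moments of the beta law *)

Section BetaMean.
Context {R : realType}.
Implicit Types (p q t c : R).

Local Notation mu := (@lebesgue_measure R).
Local Notation cont01 f := {within `[0, 1]%classic, continuous (f : R -> R)}.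

(** For p > 0 the power function is discontinuous at 0 on the line, because
    t `^ p = 1 for t < 0.  Composing with the norm gives an everywhere
    continuous function that agrees with it on [0, 1]. *)
Lemma continuous_norm_powR p : 0 <= p -> continuous (fun t : R => `|t| `^ p).
Proof.
rewrite le_eqVlt => /predU1P[<-|p0] t.
  by under eq_fun do rewrite powRr0; exact: cvg_cst.
have [->|t0] := eqVneq t 0.
  rewrite /continuous_at normr0 powR0 ?gt_eqF //.
  apply/cvgrPdist_lt => e e0; near=> u.
  rewrite sub0r normrN ger0_norm ?powR_ge0 //.
  have -> : e = (e `^ p^-1) `^ p.
    by rewrite -powRrM mulVf ?gt_eqF // powRr1 ?ltW.
  rewrite gt0_ltr_powR ?nnegrE ?normr_ge0 ?powR_ge0 //.
  near: u; apply: (@nbhs0_lt _ R); exact: powR_gt0.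
have cp : {for (`|t| : R), continuous (fun u : R => u `^ p)}.
  apply/differentiable_continuous/derivable1_diffP.
  by apply: derivable_powR; rewrite in_itv /= normr_gt0 t0.
exact: (cvg_comp (fun u : R => `|u|) _ (@norm_continuous _ _ t) cp).
Unshelve. all: by end_near. Qed.

Definition beta_weight p q t : R := t `^ p * (1 - t) `^ q.

Lemma cont01_beta_weight p q : 0 <= p -> 0 <= q -> cont01 (beta_weight p q).
Proof.
move=> p0 q0.
apply: (@subspace_eq_continuous _ _ _ (fun t : R => `|t| `^ p * `|1 - t| `^ q)).
  move=> t; rewrite inE /= in_itv /= => /andP[t0 t1].
  by rewrite /beta_weight !ger0_norm // subr_ge0.
apply: continuous_subspaceT => t; apply: cvgM.
  exact: continuous_norm_powR.
apply: (@cvg_comp _ _ _ (fun t : R => 1 - t) (fun t : R => `|t| `^ q) _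
  (nbhs (1 - t))).
  by apply: cvgB; [exact: cvg_cst|exact: cvg_id].
exact: continuous_norm_powR.
Qed.

Lemma cont01M (f g : R -> R) : cont01 f -> cont01 g ->
  cont01 (fun t : R => f t * g t).
Proof. by move=> cf cg t; apply: cvgM; [exact: cf|exact: cg]. Qed.

Lemma cont01_integrable (f : R -> R) : cont01 f ->
  mu.-integrable `[0, 1]%classic (EFin \o f).
Proof. by apply: continuous_compact_integrable; exact: segment_compact. Qed.

Lemma beta_weight_ge0 p q t : 0 <= beta_weight p q t.
Proof. by rewrite mulr_ge0 ?powR_ge0. Qed.

Lemma BetaE p q : Beta (p + 1) (q + 1) =
  \int[mu]_(t in `[0, 1]) beta_weight p q t.
Proof. by rewrite /Beta !addrK. Qed.

(** On [0, 1] a power decreases when its exponent grows, so the weight dominates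
    the one with both exponents equal to a large integer N, whose integral is
    an Euler beta function at integers. *)
Lemma Beta_gt0 p q : 0 <= p -> 0 <= q -> 0 < Beta (p + 1) (q + 1).
Proof.
move=> p0 q0; rewrite BetaE.
pose N := Num.bound (p + q).
have [pN qN] : p <= N%:R /\ q <= N%:R.
  by have := archi_boundP (addr_ge0 p0 q0); split; lra.
apply: (@lt_le_trans _ _ (beta_fun N.+1 N.+1)); first exact: beta_fun_gt0.
rewrite /beta_fun -Rintegral_mkcond /=; apply: le_Rintegral => //=.
- exact: integrable_XMonemX.
- exact/cont01_integrable/cont01_beta_weight.
move=> t; rewrite in_itv /= => /andP[t0 t1].
rewrite -[leLHS]/(t ^+ N * (1 - t) ^+ N).
have le_pow (s r : R) : 0 <= s <= 1 -> 0 <= r -> r <= N%:R -> s ^+ N <= s `^ r.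
  move=> /andP[]; rewrite le_eqVlt => /predU1P[<- _ r0 rN|s0 s1 _ rN].
    rewrite expr0n; case: eqP => [N0|_]; last exact: powR_ge0.
    have -> : r = 0 by apply/le_anti; rewrite r0 -[0]/(0%:R) -N0 rN.
    by rewrite powRr0.
  by rewrite -powR_mulrn ?(ltW s0) // ger_powR // s0 s1.
by rewrite ler_pM ?exprn_ge0 ?le_pow //; lra.
Qed.

Definition beta_mean p q (g : R -> R) : R :=
  \int[mu]_(t in `[0, 1]) (beta_weight p q t / Beta (p + 1) (q + 1) * g t).

Lemma eq_beta_mean p q g h : (forall t, 0 <= t <= 1 -> g t = h t) ->
  beta_mean p q g = beta_mean p q h.
Proof.
move=> gh; apply: eq_Rintegral => t; rewrite inE /= in_itv /= => t01.
by rewrite gh.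
Qed.

Lemma cont01_cst (c : R) : cont01 (fun _ : R => c).
Proof. by apply: continuous_subspaceT => t; exact: cvg_cst. Qed.

Lemma beta_mean_integrable p q g : 0 <= p -> 0 <= q -> cont01 g ->
  mu.-integrable `[0, 1]%classic
    (EFin \o (fun t => beta_weight p q t / Beta (p + 1) (q + 1) * g t)).
Proof.
move=> p0 q0 cg; apply: cont01_integrable; apply: cont01M => //.
by apply: cont01M; [exact: cont01_beta_weight|exact: cont01_cst].
Qed.

Lemma beta_meanD p q g h : 0 <= p -> 0 <= q -> cont01 g -> cont01 h ->
  beta_mean p q (fun t => g t + h t) = beta_mean p q g + beta_mean p q h.
Proof.
move=> p0 q0 cg ch; rewrite -RintegralD //=; [|exact: beta_mean_integrable..].
by apply: eq_Rintegral => t _; rewrite mulrDr.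
Qed.

Lemma beta_meanZ p q c g : 0 <= p -> 0 <= q -> cont01 g ->
  beta_mean p q (fun t => c * g t) = c * beta_mean p q g.
Proof.
move=> p0 q0 cg; rewrite -RintegralZl //=; last exact: beta_mean_integrable.
by apply: eq_Rintegral => t _; rewrite mulrCA.
Qed.

Lemma beta_mean_cst p q c : 0 <= p -> 0 <= q -> beta_mean p q (fun=> c) = c.
Proof.
move=> p0 q0; have B0 := Beta_gt0 p0 q0.
rewrite (@eq_beta_mean _ _ _ (fun=> c * 1)); last by move=> t _; rewrite mulr1.
rewrite beta_meanZ //; last exact: cont01_cst.
rewrite /beta_mean; under eq_Rintegral do rewrite mulr1.
rewrite RintegralZr //=; last exact/cont01_integrable/cont01_beta_weight.
by rewrite -BetaE mulfV ?mulr1 // gt_eqF.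
Qed.

Lemma beta_mean_le p q g h : 0 <= p -> 0 <= q -> cont01 g -> cont01 h ->
  (forall t, 0 <= t <= 1 -> g t <= h t) -> beta_mean p q g <= beta_mean p q h.
Proof.
move=> p0 q0 cg ch gh.
apply: le_Rintegral => //=; [exact: beta_mean_integrable..|].
move=> t; rewrite in_itv /= => t01; rewrite ler_wpM2l ?gh //.
by rewrite divr_ge0 ?beta_weight_ge0 // ltW // Beta_gt0.
Qed.

Lemma ler_norm_beta_mean p q g h : 0 <= p -> 0 <= q -> cont01 g -> cont01 h ->
  (forall t, 0 <= t <= 1 -> `|g t| <= h t) ->
  `|beta_mean p q g| <= beta_mean p q h.
Proof.
move=> p0 q0 cg ch gh; rewrite ler_norml; apply/andP; split; last first.
  apply: beta_mean_le => // t t01.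
  by apply: le_trans (gh _ t01); exact: ler_norm.
rewrite -mulN1r -beta_meanZ //; apply: beta_mean_le => // [|t t01].
  by apply: cont01M => //; exact: cont01_cst.
by rewrite mulN1r lerNl (le_trans _ (gh _ t01)) // -normrN ler_norm.
Qed.

(** Up to the factor 1 / Beta, the integrand is the derivative of
    t `^ (p + 1) * (1 - t) `^ (q + 1) * g t, which vanishes at 0 and 1. *)
Lemma beta_stein p q (g g' : R -> R) : 0 <= p -> 0 <= q ->
  (forall t, is_derive t 1 g (g' t)) -> continuous g' ->
  beta_mean p q (fun t => (p + 1 - (p + q + 2) * t) * g t + t * (1 - t) * g' t)
  = 0.
Proof.
move=> p0 q0 dg cg'.
have cg : continuous g.
  move=> t; apply/differentiable_continuous/derivable1_diffP.
  by have [] := dg t.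
set G := fun t => _ + _.
have cG : continuous G.
  move=> t; apply: cvgD; apply: cvgM => //; last exact: cg'.
    apply: cvgB; first exact: cvg_cst.
    by apply: cvgM; [exact: cvg_cst|exact: cvg_id].
  exact: cg.
  by apply: cvgM; [exact: cvg_id|apply: cvgB; [exact: cvg_cst|exact: cvg_id]].
pose F := fun t => t `^ (p + 1) * (1 - t) `^ (q + 1) * g t.
rewrite /beta_mean; under eq_Rintegral do rewrite mulrAC.
have cwG : cont01 (fun t : R => beta_weight p q t * G t).
  apply: cont01M; first exact: cont01_beta_weight.
  exact: continuous_subspaceT.
rewrite RintegralZr //=; last exact/cont01_integrable.
have cF : cont01 F.
  apply: cont01M; last exact: continuous_subspaceT.
  by apply: cont01_beta_weight; lra.
have dF t : 0 < t < 1 -> is_derive t 1 F (beta_weight p q t * G t).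
  move=> /andP[t0 t1].
  have t'0 : 0 < 1 - t by rewrite subr_gt0.
  have d1 : is_derive t 1 (fun t : R => 1 - t) (-1).
    have := is_deriveB (is_derive_cst (1 : R) (t : R) (1 : R))
      (is_derive_id (t : R) (1 : R)).
    by rewrite sub0r.
  have d2 : is_derive t 1 (fun t => (1 - t) `^ (q + 1))
      (- ((q + 1) * (1 - t) `^ q)).
    have := is_derive1_comp (g := fun t : R => 1 - t)
      (is_derive1_powR (q + 1) t'0) d1.
    by rewrite addrK mulrN1.
  have d3 : is_derive t 1 (fun t => t `^ (p + 1)) ((p + 1) * t `^ p).
    by have := is_derive1_powR (p + 1) t0; rewrite addrK.
  have := is_deriveM (is_deriveM d3 d2) (dg t).
  move=> dd; apply: (is_derive_eq dd).
  rewrite mulrfctE /G /beta_weight /GRing.scale /=.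
  have -> : t `^ (p + 1) = t * t `^ p.
    by rewrite -[in RHS](addrK 1 p) mulr_powRB1 // ?ltW //; lra.
  have -> : (1 - t) `^ (q + 1) = (1 - t) * (1 - t) `^ q.
    by rewrite -[in RHS](addrK 1 q) mulr_powRB1 // ?ltW //; lra.
  ring.
have : (\int[mu]_(t in `[0%R, 1%R]) (beta_weight p q t * G t)%:E =
    (F 1)%:E - (F 0)%:E)%E.
  apply: continuous_FTC2 => //.
    split; last 2 first.
    - by have /(continuous_within_itvP F ltr01)[] := cF.
    - by have /(continuous_within_itvP F ltr01)[] := cF.
    - by move=> t; rewrite in_itv /= => t01; have [] := dF t t01.
  move=> t; rewrite in_itv /= => t01; rewrite derive1E.
  by have [_ ->] := dF t t01.
rewrite /Rintegral => ->.
have p1 : p + 1 != 0 by rewrite gt_eqF //; lra.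
have q1 : q + 1 != 0 by rewrite gt_eqF //; lra.
by rewrite /F subrr (powR0 p1) (powR0 q1) !(mulr0, mul0r) -EFinB subrr /= mul0r.
Qed.

Lemma is_derive_exprB c n t :
  is_derive t 1 (fun u => (u - c) ^+ n) (n%:R * (t - c) ^+ n.-1).
Proof.
have d : is_derive t 1 (fun u : R => u - c) 1.
  have := is_deriveB (is_derive_id (t : R) (1 : R)) (is_derive_cst c t (1 : R)).
  by rewrite subr0.
have := is_deriveX n d; rewrite exprfctE => dn.
by apply: (is_derive_eq dn); rewrite /GRing.scale /= mulr1.
Qed.

Lemma continuous_exprB c n : continuous (fun t : R => (t - c) ^+ n).
Proof.
move=> t; apply/differentiable_continuous/derivable1_diffP.
by have [] := is_derive_exprB c n t.
Qed.

Lemma cont01_exprB c n : cont01 (fun t : R => (t - c) ^+ n).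
Proof. exact/continuous_subspaceT/continuous_exprB. Qed.

Lemma beta_mean_id p q : 0 <= p -> 0 <= q ->
  beta_mean p q id = (p + 1) / (p + q + 2).
Proof.
move=> p0 q0; have s0 : p + q + 2 != 0 by rewrite gt_eqF //; lra.
have := @beta_stein p q (fun=> 1) (fun=> 0) p0 q0
  (fun t => is_derive_cst (1 : R) t (1 : R)) (fun t => cvg_cst (0 : R)).
rewrite (@eq_beta_mean _ _ _
  (fun t => (p + 1) + - (p + q + 2) * (t - 0) ^+ 1)); last first.
  by move=> t _; ring.
rewrite beta_meanD //; [|exact: cont01_cst|]; last first.
  by apply: cont01M; [exact: cont01_cst|exact: cont01_exprB].
rewrite beta_mean_cst // beta_meanZ //; last exact: cont01_exprB.
rewrite (@eq_beta_mean _ _ _ id) => [e|t _]; last by ring.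
apply: (mulfI s0); rewrite mulrCA mulfV // mulr1.
by apply/esym/eqP; rewrite -subr_eq0 -[X in _ == X]e mulNr.
Qed.

(** Stein's identity for (t - c) ^+ n.+1: as c is the mean, its first term is
    - (p + q + 2) * (t - c) ^+ n.+2.  Since t * (1 - t) <= 1 / 4, each use
    trades two orders of the central moment for a factor of order
    1 / (p + q). *)
Lemma beta_central_moment p q n : 0 <= p -> 0 <= q ->
  let c := (p + 1) / (p + q + 2) in
  (p + q + 2) * beta_mean p q (fun t => (t - c) ^+ n.+2) =
  n.+1%:R * beta_mean p q (fun t => t * (1 - t) * (t - c) ^+ n).
Proof.
move=> p0 q0 c; have s0 : p + q + 2 != 0 by rewrite gt_eqF //; lra.
have cv : cont01 (fun t : R => t * (1 - t) * (t - c) ^+ n).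
  apply: cont01M; last exact: cont01_exprB.
  apply: cont01M; apply: continuous_subspaceT => t; first exact: cvg_id.
  by apply: cvgB; [exact: cvg_cst|exact: cvg_id].
have := @beta_stein p q _ _ p0 q0 (is_derive_exprB c n.+1) _.
rewrite (@eq_beta_mean _ _ _ (fun t => - (p + q + 2) * (t - c) ^+ n.+2
   + n.+1%:R * (t * (1 - t) * (t - c) ^+ n))); last first.
  move=> t _; have -> : p + 1 = c * (p + q + 2) by rewrite divfK.
  by rewrite /= !exprS; ring.
have cc k : cont01 (fun t : R => k * (t - c) ^+ n.+2).
  by apply: cont01M; [exact: cont01_cst|exact: cont01_exprB].
rewrite beta_meanD //; last by apply: cont01M => //; exact: cont01_cst.
rewrite !beta_meanZ //; last exact: cont01_exprB.
move=> H; apply/eqP; rewrite -subr_eq0 -oppr_eq0 opprB addrC -mulNr H //.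
move=> t; apply: cvgM; first exact: cvg_cst.
exact: continuous_exprB.
Qed.

Lemma beta_central_moment4_le p q : 0 <= p -> 0 <= q ->
  (p + q + 2) ^+ 2 *
    beta_mean p q (fun t => (t - (p + 1) / (p + q + 2)) ^+ 4) <= 1.
Proof.
move=> p0 q0; set c := (p + 1) / _.
have half n : (forall t, 0 <= (t - c) ^+ n) ->
    beta_mean p q (fun t => t * (1 - t) * (t - c) ^+ n) <=
    1 / 4 * beta_mean p q (fun t => (t - c) ^+ n).
  move=> n0; rewrite -beta_meanZ //; last exact: cont01_exprB.
  apply: beta_mean_le => //.
  - apply: cont01M; last exact: cont01_exprB.
    apply: cont01M; apply: continuous_subspaceT => t; first exact: cvg_id.
    by apply: cvgB; [exact: cvg_cst|exact: cvg_id].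
  - by apply: cont01M; [exact: cont01_cst|exact: cont01_exprB].
  - move=> t _; apply: ler_wpM2r => //.
    by have := sqr_ge0 (t - 1 / 2); nra.
have := beta_central_moment 0 p0 q0; have := beta_central_moment 2 p0 q0.
rewrite -/c /=.
have := half 0%N (fun=> ler01).
rewrite (@eq_beta_mean _ _ (fun t => (t - c) ^+ 0) (fun=> 1)) //.
rewrite beta_mean_cst //.
have := half 2%N (fun t => sqr_ge0 _).
have s0 : 0 < p + q + 2 by lra.
set s := p + q + 2 in s0 *.
set E4 := beta_mean _ _ _; set E2 := beta_mean _ _ (fun t => (t - c) ^+ 2).
set v2 := beta_mean _ _ _; set v0 := beta_mean _ _ _.
move=> h2 h0 e4 e2.
nra.
Qed.

End BetaMean.

(** * Modulus of continuity and Taylor remainder on [0, 1] *)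

Section Taylor.
Context {R : realType}.
Implicit Types (f g : R -> R) (c d t x y z : R).
Local Notation cont01 f := {within `[0, 1]%classic, continuous (f : R -> R)}.

(** Continuity on the compact interval makes the set of oscillations bounded,
    without which its supremum would carry no information. *)
Lemma modulus01_ge g d y z : cont01 g -> 0 <= y <= 1 -> 0 <= z <= 1 ->
  `|y - z| <= d -> `|g y - g z| <= modulus01 g d.
Proof.
move=> cg y01 z01 yz.
have /compact_bounded [M [_ Mg]] :=
  continuous_compact cg (@segment_compact R 0 1).
have gM u : 0 <= u <= 1 -> `|g u| <= M + 1.
  move=> u01; apply: (Mg (M + 1)); first by rewrite ltrDl.
  by exists u; rewrite //= in_itv.
rewrite /modulus01; apply: ub_le_sup; last first.
  by exists y, z; split => //; rewrite in_itv.
exists (M + 1 + (M + 1)) => _ [u [v [+ + _ ->]]].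
rewrite !in_itv /= => u01 v01; apply: le_trans (ler_normB _ _) _.
by rewrite lerD ?gM.
Qed.

Lemma modulus01_ge0 g d : cont01 g -> 0 <= d -> 0 <= modulus01 g d.
Proof.
move=> cg d0; apply: le_trans (normr_ge0 (g 0 - g 0)) _.
by apply: modulus01_ge => //; rewrite ?lexx ?ler01 // subrr normr0.
Qed.

(** Cut the segment from z to y into N equal steps, each of length at most d;
    convexity keeps the division points in [0, 1]. *)
Lemma modulus01_chain g d N y z : cont01 g -> 0 <= y <= 1 -> 0 <= z <= 1 ->
  `|y - z| <= N%:R * d -> `|g y - g z| <= N%:R * modulus01 g d.
Proof.
move=> cg + z01; elim: N y => [|N IH] y y01.
  rewrite !mul0r normr_le0 subr_eq0 => /eqP ->.
  by rewrite subrr normr0.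
move=> yz; pose u := z + N%:R / N.+1%:R * (y - z).
have N1 : N.+1%:R != 0 :> R by [].
have l01 : 0 <= N%:R / N.+1%:R :> R by [].
have l1 : N%:R / N.+1%:R <= 1 :> R by rewrite ler_pdivrMr // mul1r ler_nat.
have u01 : 0 <= u <= 1.
  set l := (N%:R / N.+1%:R) in l01 l1 *; have -> : u = (1 - l) * z + l * y.
    by rewrite /u -/l; ring.
  move/andP: z01 => [z0 z1]; move/andP: y01 => [y0 y1].
  have l'0 : 0 <= 1 - l by rewrite subr_ge0.
  rewrite addr_ge0 ?mulr_ge0 //= -[leRHS](subrK l 1) lerD //.
    by rewrite ler_piMr.
  by rewrite ler_piMr.
have yz' : `|y - z| / N.+1%:R <= d by rewrite ler_pdivrMr // mulrC.
have -> : g y - g z = (g y - g u) + (g u - g z) by ring.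
apply: le_trans (ler_normD _ _) _.
rewrite -natr1 mulrDl mul1r addrC lerD //.
  apply: IH => //.
  have -> : u - z = N%:R * ((y - z) / N.+1%:R) by rewrite /u; field.
  by rewrite normrM normr_nat ler_wpM2l // normrM normfV normr_nat.
apply: modulus01_ge => //.
have -> : y - u = (y - z) / N.+1%:R.
  by rewrite /u -natr1; field; rewrite natr1.
by rewrite normrM normfV normr_nat.
Qed.

(** Take one step more than the integer part of |y - z| / d. *)
Lemma modulus01_lin g d y z :
  cont01 g -> 0 <= y <= 1 -> 0 <= z <= 1 -> 0 < d ->
  `|g y - g z| <= (1 + `|y - z| / d) * modulus01 g d.
Proof.
move=> cg y01 z01 d0.
have w0 : 0 <= modulus01 g d.
  by apply: modulus01_ge0 cg _; exact: ltW.
have l0 : 0 <= `|y - z| / d by rewrite divr_ge0 // ltW.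
apply: (@le_trans _ _ ((Num.truncn (`|y - z| / d)).+1%:R * modulus01 g d)).
  apply: modulus01_chain => //; rewrite -ler_pdivrMr //.
  by apply/ltW/truncnS_gt.
rewrite ler_wpM2r // -natr1 addrC lerD2l.
by rewrite truncn_le.
Qed.

Lemma derivable01P f x : derivable01 f x -> forall e : R, 0 < e ->
  exists2 r, 0 < r & forall y, 0 <= y <= 1 -> y != x -> `|y - x| < r ->
    `|(f y - f x) / (y - x) - deriv01 f x| < e.
Proof.
move=> df e e0.
set L := deriv01 f x.
have {df} : diff_quot f x y @[y --> within `[0, 1]%classic (dnbhs x)] --> L.
  exact: df.
move/cvgrPdist_lt => /(_ e e0).
have -> : (\forall t \near within `[0, 1]%classic (dnbhs x),
    `|L - diff_quot f x t| < e)
  = nbhs x (fun y => y != x -> y \in `[0, 1] -> `|L - diff_quot f x y| < e).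
  by [].
move=> /nbhs_ballP [r /= r0 xr]; exists r => // y y01 yx yr.
rewrite distrC; apply: xr => //.
by rewrite /ball /= distrC.
Qed.

Lemma derivable01_continuous f :
  (forall x, 0 <= x <= 1 -> derivable01 f x) -> cont01 f.
Proof.
move=> df; apply/subspace_continuousP => x /=; rewrite in_itv /= => x01.
have [r r0 hr] := derivable01P (df x x01) ltr01.
set L := deriv01 f x in hr.
have L0 : 0 < `|L| + 1 by rewrite ltr_wpDl.
apply/cvgrPdist_lt => e e0.
apply/nbhs_ballP; exists (Num.min r (e / (`|L| + 1))) => /=.
  by rewrite lt_min r0 divr_gt0.
move=> y; rewrite /ball /= lt_min distrC => /andP[yr ye].
rewrite in_itv /= => y01.
have [->|yx] := eqVneq y x; first by rewrite subrr normr0.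
have := hr y y01 yx yr; set q := _ / _ => qL.
have -> : f x - f y = - (q * (y - x)) by rewrite /q divfK ?subr_eq0 //; ring.
rewrite normrN normrM; apply: le_lt_trans (_ : (`|L| + 1) * `|y - x| < _).
  rewrite ler_wpM2r //; have -> : q = L + (q - L) by ring.
  by apply: le_trans (ler_normD _ _) _; rewrite lerD2l ltW.
by rewrite mulrC -ltr_pdivlMr.
Qed.

Lemma derivable01_is_derive f x : 0 < x < 1 -> derivable01 f x ->
  is_derive x 1 f (deriv01 f x).
Proof.
move=> /andP[x0 x1] /derivable01P df.
have H : h^-1 *: (f (h *: (1 : R) + x) - f x) @[h --> (0 : R)^']
    --> deriv01 f x.
  apply/cvgrPdist_lt => e e0; have [r r0 hr] := df e e0.
  apply/nbhs_ballP; exists (Num.min r (Num.min x (1 - x))) => /=.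
    by rewrite !lt_min r0 x0 subr_gt0.
  move=> h; rewrite /ball /= sub0r normrN !lt_min => /and3P[h1 h2 h3] h0.
  have hx01 : 0 <= h + x <= 1.
    by move: h2 h3; rewrite !ltr_norml => /andP[? ?] /andP[? ?]; lra.
  have hxx : h + x != x by rewrite -subr_eq0 addrK.
  have := hr (h + x) hx01 hxx; rewrite addrK => /(_ h1).
  by rewrite distrC mulrC /GRing.scale /= mulr1.
by apply: DeriveDef; [exact: cvgP H|exact: cvg_lim H].
Qed.

(** The mean value theorem from a base point x, with t on either side of x. *)
Lemma MVT01 (g g' : R -> R) (x t : R) :
  0 <= x <= 1 -> 0 <= t <= 1 -> cont01 g ->
  (forall c : R, 0 < c < 1 -> is_derive c 1 g (g' c)) ->
  exists c : R,
    [/\ 0 <= c <= 1, `|c - x| <= `|t - x| & g t - g x = g' c * (t - x)].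
Proof.
move=> x01 t01 cg dg.
have cgab a b : 0 <= a -> b <= 1 -> {within `[a, b]%classic, continuous g}.
  move=> a0 b1; apply: continuous_subspaceW cg => u /=; rewrite !in_itv /=.
  by move=> /andP[? ?]; apply/andP; split; lra.
move/andP: x01 => [x0 x1]; move/andP: t01 => [t0 t1].
have [xt|xt|->] := ltgtP x t.
- have [|c] := MVT (df := g') xt _ (cgab _ _ x0 t1).
    by move=> u; rewrite in_itv /= => /andP[? ?]; apply: dg; lra.
  rewrite in_itv /= => /andP[c1 c2] e; exists c; split => //; first by lra.
  by rewrite !ger0_norm ?subr_ge0 ?lerD2r ?ltW.
- have [|c] := MVT (df := g') xt _ (cgab _ _ t0 x1).
    by move=> u; rewrite in_itv /= => /andP[? ?]; apply: dg; lra.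
  rewrite in_itv /= => /andP[c1 c2] e; exists c; split => //; first by lra.
    by rewrite !ler0_norm ?subr_le0 ?opprB ?lerD2l ?lerN2 ?ltW.
  by rewrite -opprB e -mulrN opprB.
- by exists t; split; rewrite ?subrr ?mulr0 // t0.
Qed.

(** The mean value theorem applied to the Taylor remainder and then to its
    derivative.  This gives the factor 1 where the integral form of the
    remainder would give 1 / 2, which only affects the constant. *)
Lemma taylor2 f x (t : R) : C2_01 f -> 0 <= x <= 1 -> 0 <= t <= 1 ->
  exists d : R, [/\ 0 <= d <= 1, `|d - x| <= `|t - x| &
    `|f t - f x - deriv01 f x * (t - x)
      - 1 / 2 * deriv01 (deriv01 f) x * (t - x) ^+ 2|
    <= `|deriv01 (deriv01 f) d - deriv01 (deriv01 f) x| * (t - x) ^+ 2].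
Proof.
move=> [df ddf _] x01 t01.
have {}df y : 0 <= y <= 1 -> derivable01 f y.
  by move=> ?; apply: df; rewrite in_itv.
have {}ddf y : 0 <= y <= 1 -> derivable01 (deriv01 f) y.
  by move=> ?; apply: ddf; rewrite in_itv.
set f1 := deriv01 f in ddf *; set f2 := deriv01 f1.
have oo c : 0 < c < 1 -> 0 <= c <= 1 by move=> /andP[? ?]; rewrite !ltW.
pose r u := f u - (f1 x * u + 1 / 2 * f2 x * (u - x) ^+ 2).
pose r1 u := f1 u - (f1 x + f2 x * (u - x)).
have cid : continuous (fun u : R => u) by move=> u; exact: cvg_id.
have ccst (k : R) : continuous (fun u : R => k) by move=> u; exact: cvg_cst.
have caff (k : R) : continuous (fun u : R => k * u).
  by move=> u; apply: cvgM; [exact: ccst|exact: cid].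
have [c [c01 cx ec]] : exists c : R, [/\ 0 <= c <= 1, `|c - x| <= `|t - x| &
    r t - r x = r1 c * (t - x)].
  apply: MVT01 => //.
    have cq : continuous (fun u => f1 x * u + 1 / 2 * f2 x * (u - x) ^+ 2).
      move=> u; apply: cvgD; first exact: caff.
      by apply: cvgM; [exact: ccst|exact: continuous_exprB].
    move=> u; apply: cvgB; first exact: derivable01_continuous.
    exact: (continuous_subspaceT cq).
  move=> u u01.
  have := is_deriveB (derivable01_is_derive u01 (df u (oo u u01)))
    (is_deriveD (is_deriveM (is_derive_cst (f1 x) (u : R) (1 : R))
        (is_derive_id (u : R) (1 : R)))
      (is_deriveM (is_derive_cst (1 / 2 * f2 x) (u : R) (1 : R))
        (is_derive_exprB x 2 u))).
  by move=> d; apply: (is_derive_eq d); rewrite /r1 -/f1 /GRing.scale /=; field.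
have [d [d01 dx ed]] : exists d : R, [/\ 0 <= d <= 1, `|d - x| <= `|c - x| &
    r1 c - r1 x = (f2 d - f2 x) * (c - x)].
  apply: MVT01 => //.
    have cl : continuous (fun u => f1 x + f2 x * (u - x)).
      move=> u; apply: cvgD; first exact: ccst.
      by apply: cvgM; [exact: ccst|apply: cvgB; [exact: cid|exact: ccst]].
    move=> u; apply: cvgB; first exact: derivable01_continuous.
    exact: (continuous_subspaceT cl).
  move=> u u01.
  have := is_deriveB (derivable01_is_derive u01 (ddf u (oo u u01)))
    (is_deriveD (is_derive_cst (f1 x) (u : R) (1 : R))
      (is_deriveM (is_derive_cst (f2 x) (u : R) (1 : R))
        (is_derive_exprB x 1 u))).
  by move=> d; apply: (is_derive_eq d); rewrite -/f2 /GRing.scale /=; ring.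
exists d; split => //; first exact: le_trans cx.
have -> : f t - f x - f1 x * (t - x) - 1 / 2 * f2 x * (t - x) ^+ 2 =
    (f2 d - f2 x) * (c - x) * (t - x).
  transitivity (r t - r x); first by rewrite /r; ring.
  by rewrite ec -ed; congr (_ * _); rewrite /r1; ring.
rewrite -mulrA normrM ler_wpM2l // normrM -[leRHS]ger0_norm ?sqr_ge0 // normrX.
by rewrite expr2 ler_wpM2r.
Qed.

End Taylor.

(** * The operator *)

Section Paltanea.
Context {R : realType}.
Implicit Types (alpha rho c x : R) (n k m : nat) (f g h : R -> R).
Local Notation cont01 f := {within `[0, 1]%classic, continuous (f : R -> R)}.

Definition paltanea_mean rho n k f : R :=
  beta_mean (k%:R * rho) ((n - k)%:R * rho) f.

Lemma paltanea_total rho n k : (k <= n)%N ->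
  k%:R * rho + (n - k)%:R * rho + 2 = n%:R * rho + 2.
Proof. by move=> kn; rewrite -mulrDl -natrD subnKC. Qed.

Lemma paltanea_mean_id rho n k : 0 < rho -> (k <= n)%N ->
  paltanea_mean rho n k id = (k%:R * rho + 1) / (n%:R * rho + 2).
Proof.
move=> r0 kn; rewrite /paltanea_mean beta_mean_id ?paltanea_total //;
  by rewrite mulr_ge0 // ltW.
Qed.

(** Split s (t - x) into s (t - c) and s (c - x), where s = n rho + 2 and
    c = (k rho + 1) / s is the mean of the beta law. *)
Lemma paltanea_moment4_le rho n k x : 0 < rho -> (k <= n)%N ->
  (n%:R * rho + 2) ^+ 4 * paltanea_mean rho n k (fun t => (t - x) ^+ 4) <=
    8 * ((n%:R * rho + 2) ^+ 2
         + (k%:R * rho + 1 - (n%:R * rho + 2) * x) ^+ 4) :> R.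
Proof.
move=> r0 kn; set s := n%:R * rho + 2; rewrite /paltanea_mean.
set p := _ * rho; set q := _ * rho.
have p0 : 0 <= p by rewrite mulr_ge0 // ltW.
have q0 : 0 <= q by rewrite mulr_ge0 // ltW.
have es : p + q + 2 = s by exact: paltanea_total.
have s0 : 0 < s by rewrite -es; lra.
have := beta_central_moment4_le p0 q0; rewrite es.
set c := (p + 1) / s; set E := beta_mean _ _ _ => hE.
have cE (k4 d : R) : cont01 (fun t => k4 * (t - d) ^+ 4).
  by apply: cont01M; [exact: cont01_cst|exact: cont01_exprB].
rewrite -beta_meanZ //; last exact: cont01_exprB.
apply: (@le_trans _ _ (beta_mean p q (fun t =>
    8 * s ^+ 4 * (t - c) ^+ 4 + 8 * (p + 1 - s * x) ^+ 4))).
  apply: beta_mean_le => //.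
    by move=> t; apply: cvgD; [exact: cE|exact: cont01_cst].
  move=> t _; have := exprD4_le (s * (t - c)) (p + 1 - s * x).
  have -> : s * (t - c) + (p + 1 - s * x) = s * (t - x).
    by rewrite /c; field; rewrite gt_eqF.
  rewrite !exprMn; set d := (_ - s * x) ^+ 4; lra.
rewrite beta_meanD ?beta_mean_cst //; last exact: cont01_cst.
rewrite beta_meanZ -/E //; last exact: cont01_exprB.
rewrite mulrDr lerD2r.
rewrite (_ : 8 * s ^+ 4 * E = 8 * s ^+ 2 * (s ^+ 2 * E)); last by ring.
rewrite -[leRHS]mulr1; apply: ler_wpM2l hE.
by rewrite mulr_ge0 ?sqr_ge0.
Qed.

(** p_(m,k) vanishes at k = m + 1 and p_(m,k-1) at k = 0; reindexing the second
    sum puts both averages on the same weights. *)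
Lemma JM1E alpha rho (a0 a1 : nat -> R) m f x :
  JM1 alpha rho a0 a1 m.+1 f x =
  lin_coef a0 a1 x m.+1 *
    alpha_bernstein_mean alpha m x (paltanea_mean rho m.+1 ^~ f)
  + lin_coef a0 a1 (1 - x) m.+1 *
    alpha_bernstein_mean alpha m x (fun k => paltanea_mean rho m.+1 k.+1 f).
Proof.
rewrite /JM1 subn1 /= /alpha_bernstein_mean.
under eq_bigr do rewrite mulrDl.
rewrite big_split /=; congr (_ + _).
  rewrite big_ord_recr /= alpha_bernstein_gt // mulr0 mul0r addr0 mulr_sumr.
  by apply: eq_bigr => k _; rewrite mulrA.
rewrite big_ord_recl /= mulr0 mul0r add0r mulr_sumr.
by apply: eq_bigr => k _; rewrite mulrA.
Qed.

Lemma ler_norm_lin_coef rho (a0 a1 : nat -> R) x n :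
  0 < rho -> 0 <= x <= 1 ->
  a0 n = (rho + 1) / rho -> a1 n = - ((rho + 2) / rho) ->
  `|lin_coef a0 a1 x n| <= (rho + 2) / rho.
Proof.
move=> r0 /andP[x0 x1] a0E a1E; rewrite /lin_coef a0E a1E.
have -> : - ((rho + 2) / rho) * x + (rho + 1) / rho =
  (rho + 1 - (rho + 2) * x) / rho by ring.
have ir0 : 0 <= rho^-1 by rewrite invr_ge0 ltW.
rewrite normrM (ger0_norm ir0) ler_wpM2r // ler_norml; apply/andP; split; nra.
Qed.

(** 9728 = 64 * 152, where 64 = 8 * 8 comes from splitting a fourth power twice
    and 152 from the fourth moment of the weights; 16 = 64 / 4 because the
    bounded term is compared with s ^ 2 >= 4. *)
Definition moment4_const rho : R := 8 + 9728 * rho ^+ 2 + 16 * (rho + 2) ^+ 4.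

Lemma moment4_const_ge0 rho : 0 <= moment4_const rho.
Proof.
rewrite /moment4_const; have := sqr_ge0 rho.
by have := sqr_ge0 ((rho + 2) ^+ 2); rewrite -exprM; lra.
Qed.

(** The affine part of the Taylor polynomial is reproduced by the signed
    combination of weights A and 1 - A when the combined means y0, y1 give x;
    its quadratic part is exactly the second order term, and only the means
    u0, u1 of the remainder survive. *)
Lemma combine_remainders (A x y0 y1 u0 u1 q0 q1 v v1 v2 : R) :
  A * y0 + (1 - A) * y1 = x ->
  A * (u0 + (v + (v1 * (y0 - x) + 1 / 2 * v2 * q0)))
  + (1 - A) * (u1 + (v + (v1 * (y1 - x) + 1 / 2 * v2 * q1)))
  - v - 1 / 2 * (A * q0 + (1 - A) * q1) * v2 = A * u0 + (1 - A) * u1.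
Proof. by move=> <-; ring. Qed.

Lemma ler_norm_combination (a b u v c d : R) :
  `|a| <= c -> `|b| <= c -> `|u| <= d -> `|v| <= d ->
  `|a * u + b * v| <= c * d *+ 2.
Proof.
move=> ac bc ud vd; apply: le_trans (ler_normD _ _) _.
by rewrite !normrM mulr2n lerD // ler_pM.
Qed.

(** The index i = 0 or 1 covers both sums, over p_(m,k) and over p_(m,k-1), of
    the operator. *)
Lemma composed_moment4_le alpha rho m i x :
  0 <= alpha <= 1 -> 0 < rho -> 0 <= x <= 1 -> (0 < m)%N -> (i <= 1)%N ->
  alpha_bernstein_mean alpha m x
    (fun k => paltanea_mean rho m.+1 (k + i) (fun t => (t - x) ^+ 4)) <=
  moment4_const rho / rho ^+ 2 / m.+1%:R ^+ 2.
Proof.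
move=> al01 r0 x01 m0 i1; have /andP[x0 x1] := x01.
set s : R := m.+1%:R * rho + 2.
have n0 : 0 < m.+1%:R :> R by [].
have s2 : 2 <= s by rewrite lerDr mulr_ge0 // ltW.
set P := alpha_bernstein_mean _ _ _ _.
have r4 : 0 <= rho ^+ 4 by rewrite exprn_ge0 // ltW.
have hP : s ^+ 4 * P <= 8 * s ^+ 2 + 64 * (rho + 2) ^+ 4
    + 64 * rho ^+ 4 * (152 * m%:R ^+ 2).
  rewrite -alpha_bernstein_meanZ.
  apply: (@le_trans _ _ (alpha_bernstein_mean alpha m x (fun k =>
     (8 * s ^+ 2 + 64 * (rho + 2) ^+ 4)
     + 64 * rho ^+ 4 * (k%:R - m%:R * x) ^+ 4))).
    apply: alpha_bernstein_mean_le => // k km.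
    have kin : (k + i <= m.+1)%N by rewrite -addn1 leq_add.
    apply: le_trans (paltanea_moment4_le x r0 kin) _; rewrite -/s.
    (* e is the part of s (c - x) that does not depend on k: s = (m + 1) rho + 2
       exceeds m rho by rho + 2. *)
    set e : R := i%:R * rho + 1 - (rho + 2) * x.
    have -> : (k + i)%:R * rho + 1 - s * x = rho * (k%:R - m%:R * x) + e.
      by rewrite /s /e natrD -[m.+1%:R]natr1; ring.
    have := exprD4_le (rho * (k%:R - m%:R * x)) e; rewrite exprMn.
    have : e ^+ 4 <= (rho + 2) ^+ 4.
      rewrite -[e ^+ 4]ger0_norm ?(exprn_even_ge0 (n := 4)) // normrX.
      rewrite lerXn2r ?nnegrE //; first by lra.
      rewrite ler_norml /e; case: i i1 {P kin e} => [|[|//]] _ /=;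
        apply/andP; split; nra.
    by lra.
  rewrite alpha_bernstein_meanD alpha_bernstein_mean_cst //.
  rewrite alpha_bernstein_meanZ.
  rewrite lerD2l; apply: ler_wpM2l; first by rewrite mulr_ge0.
  exact: alpha_bernstein_moment4_le.
have sm : rho * m%:R <= s by rewrite /s -natr1; nra.
have sn : rho * m.+1%:R <= s by rewrite /s; nra.
have s0 : 0 < s by lra.
have hs : s ^+ 2 * P <= moment4_const rho.
  rewrite -(ler_pM2l (_ : 0 < s ^+ 2)) ?exprn_gt0 // mulrA -exprD.
  apply: le_trans hP _; rewrite /moment4_const !mulrDr.
  have h1 : 4 <= s ^+ 2 by nra.
  have h2 : (rho * m%:R) ^+ 2 <= s ^+ 2.
    by rewrite lerXn2r ?nnegrE ?mulr_ge0 // ltW.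
  have h3 : 0 <= (rho + 2) ^+ 4 by rewrite exprn_ge0 //; lra.
  have h4 := sqr_ge0 rho.
  have h5 : rho ^+ 4 * m%:R ^+ 2 <= rho ^+ 2 * s ^+ 2.
    rewrite (_ : rho ^+ 4 * _ = rho ^+ 2 * (rho * m%:R) ^+ 2); last by ring.
    by rewrite ler_wpM2l.
  by nra.
have P0 : 0 <= P.
  rewrite -(alpha_bernstein_mean_cst alpha x 0 m0).
  apply: alpha_bernstein_mean_le => // k km.
  have p0 : 0 <= (k + i)%:R * rho by rewrite mulr_ge0 // ltW.
  have q0 : 0 <= (m.+1 - (k + i))%:R * rho by rewrite mulr_ge0 // ltW.
  rewrite -[X in X <= _](beta_mean_cst 0 p0 q0); apply: beta_mean_le => //.
  - exact: cont01_cst.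
  - exact: cont01_exprB.
  - by move=> t _; rewrite (exprn_even_ge0 (n := 4)).
rewrite -mulrA -invfM -exprMn ler_pdivlMr ?exprn_gt0 ?mulr_gt0 //.
rewrite mulrC; apply: le_trans hs; rewrite ler_wpM2r //.
by rewrite lerXn2r ?nnegrE ?mulr_ge0 // ltW.
Qed.

(** With u = sqrt n * |t - x|, the remainder is at most
    w * u ^ 2 * (1 + u) / n, and u ^ 2 * (1 + u) <= 2 + 2 * u ^ 4: this way the
    fourth moment alone controls the operator. *)
Lemma taylor_remainder_le f x (t : R) n :
  C2_01 f -> 0 <= x <= 1 -> 0 <= t <= 1 -> (0 < n)%N ->
  `|f t - (f x + (deriv01 f x * (t - x)
       + 1 / 2 * deriv01 (deriv01 f) x * (t - x) ^+ 2))|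
  <= modulus01 (deriv01 (deriv01 f)) (1 / Num.sqrt n%:R) *
     (2 / n%:R + 2 * n%:R * (t - x) ^+ 4).
Proof.
move=> hf x01 t01 n0; have [_ _ cf2] := hf.
have [d [d01 dx]] := taylor2 hf x01 t01.
set f2 := deriv01 (deriv01 f) in cf2 *; set w := modulus01 _ _.
have -> : f t - (f x + (deriv01 f x * (t - x)
      + 1 / 2 * f2 x * (t - x) ^+ 2)) =
  f t - f x - deriv01 f x * (t - x) - 1 / 2 * f2 x * (t - x) ^+ 2 by ring.
move=> hd; apply: le_trans hd _.
have nR0 : 0 < n%:R :> R by rewrite ltr0n.
set r := Num.sqrt (n%:R : R); have r0 : 0 < r by rewrite sqrtr_gt0.
have rr : r ^+ 2 = n%:R by rewrite sqr_sqrtr // ltW.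
have ir0 : 0 < 1 / r by rewrite divr_gt0.
have := modulus01_lin cf2 d01 x01 ir0; rewrite -/w => hw.
have w0 : 0 <= w.
  by apply: modulus01_ge0 cf2 _; exact: ltW.
set v := `|t - x| in dx *; have v0 : 0 <= v by exact: normr_ge0.
have ev2 : (t - x) ^+ 2 = v ^+ 2 by rewrite real_normK ?num_real.
have ev4 : (t - x) ^+ 4 = v ^+ 4 by rewrite (exprM _ 2 2) ev2 -exprM.
rewrite ev2 ev4.
have {}hw : `|f2 d - f2 x| <= (1 + r * v) * w.
  apply: le_trans hw _; rewrite ler_wpM2r // lerD2l div1r invrK mulrC.
  by rewrite ler_wpM2l // ltW.
apply: (@le_trans _ _ ((1 + r * v) * w * v ^+ 2)).
  by rewrite ler_wpM2r ?sqr_ge0.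
rewrite (_ : _ * v ^+ 2 = w * ((1 + r * v) * v ^+ 2)); last by ring.
rewrite ler_wpM2l // -rr.
have -> : 2 / r ^+ 2 + 2 * r ^+ 2 * v ^+ 4 = (2 + 2 * (r * v) ^+ 4) / r ^+ 2.
  by field; rewrite gt_eqF.
rewrite ler_pdivlMr ?exprn_gt0 //.
have u0 : 0 <= r * v by rewrite mulr_ge0 // ltW.
rewrite (_ : _ * r ^+ 2 = (1 + r * v) * (r * v) ^+ 2); last by ring.
set u := r * v in u0 *.
have := sqr_ge0 (u ^+ 2 - u); have := sqr_ge0 (u ^+ 2 - 1).
nra.
Qed.

(** The left-hand side is the operator applied to the Taylor remainder, a
    combination of two means with coefficients at most (rho + 2) / rho in
    absolute value; each mean is at most 2 (1 + K) w / n, where K / n ^ 2 bounds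
    the fourth moment and w is the modulus. *)
Lemma JM1_voronovskaya_le alpha rho (a0 a1 : nat -> R) m f x :
  0 <= alpha <= 1 -> 0 < rho -> 0 <= x <= 1 -> (0 < m)%N -> C2_01 f ->
  a0 m.+1 = (rho + 1) / rho -> a1 m.+1 = - ((rho + 2) / rho) ->
  `| JM1 alpha rho a0 a1 m.+1 f x - f x
     - 1 / 2 * JM1 alpha rho a0 a1 m.+1 (fun t => (t - x) ^+ 2) x
       * deriv01 (deriv01 f) x |
  <= 4 * ((rho + 2) / rho) * (1 + moment4_const rho / rho ^+ 2) * (1 / m.+1%:R)
     * modulus01 (deriv01 (deriv01 f)) (1 / Num.sqrt m.+1%:R).
Proof.
move=> al01 r0 x01 m0 hf a0E a1E.
have [df _ cf2] := hf.
set n := m.+1 in a0E a1E *; set K := moment4_const rho / rho ^+ 2.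
set f2 := deriv01 (deriv01 f) x; set w := modulus01 _ _.
set f1 := deriv01 f x.
have n0 : 0 < n%:R :> R by [].
set s := n%:R * rho + 2.
have s0 : s != 0 by rewrite gt_eqF // ltr_wpDl // mulr_ge0 // ltW.
have w0 : 0 <= w.
  by apply: modulus01_ge0 cf2 _; rewrite divr_ge0 ?sqrtr_ge0.
have cf : cont01 f.
  by apply: derivable01_continuous => y y01; apply: df; rewrite in_itv.
have c1 : cont01 (fun t => t - x).
  apply: continuous_subspaceT => t.
  by apply: cvgB; [exact: cvg_id|exact: cvg_cst].
have cf1 : cont01 (fun t => f1 * (t - x)).
  by apply: cont01M; [exact: cont01_cst|exact: c1].
have cl c j : cont01 (fun t => c * (t - x) ^+ j).
  by apply: cont01M; [exact: cont01_cst|exact: cont01_exprB].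
have cq : cont01 (fun t => f1 * (t - x) + 1 / 2 * f2 * (t - x) ^+ 2).
  by move=> t; apply: cvgD; [exact: cf1|exact: cl].
have cT : cont01 (fun t => f x + (f1 * (t - x) + 1 / 2 * f2 * (t - x) ^+ 2)).
  by move=> t; apply: cvgD; [exact: cont01_cst|exact: cq].
pose r t := f t - (f x + (f1 * (t - x) + 1 / 2 * f2 * (t - x) ^+ 2)).
have cr : cont01 r by move=> t; apply: cvgB; [exact: cf|exact: cT].
pose E k := paltanea_mean rho n k.
have pq k : 0 <= k%:R * rho /\ 0 <= (n - k)%:R * rho.
  by rewrite !mulr_ge0 // ltW.
have Ef k : (k <= n)%N ->
    E k f = E k r + (f x + (f1 * ((k%:R * rho + 1) / s - x)
      + 1 / 2 * f2 * E k (fun t => (t - x) ^+ 2))).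
  move=> kn; have [p0 q0] := pq k.
  have Eid : E k (fun t => t - x) = (k%:R * rho + 1) / s - x.
    rewrite -paltanea_mean_id // /E /paltanea_mean beta_meanD ?beta_mean_cst //.
      by apply: continuous_subspaceT => t; exact: cvg_id.
    exact: cont01_cst.
  rewrite -Eid /E /paltanea_mean -!beta_meanZ //; last exact: cont01_exprB.
  rewrite -[in RHS](beta_mean_cst (f x) p0 q0) -!beta_meanD //.
    by apply: eq_beta_mean => t _; rewrite /r subrK.
  exact: cont01_cst.
pose P i g := alpha_bernstein_mean alpha m x (fun k => E (k + i)%N g).
have Pf i : (i <= 1)%N -> P i f = P i r + (f x
    + (f1 * (((m%:R * x + i%:R) * rho + 1) / s - x)
       + 1 / 2 * f2 * P i (fun t => (t - x) ^+ 2))).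
  move=> i1; transitivity (alpha_bernstein_mean alpha m x (fun k =>
     E (k + i)%N r + ((f x + f1 * ((i%:R * rho + 1) / s - x))
        + (f1 * (rho / s) * k%:R
        + 1 / 2 * f2 * E (k + i)%N (fun t => (t - x) ^+ 2))))).
    apply: eq_bigr => k _; congr (_ * _); rewrite Ef; last first.
      by rewrite -[n]addn1 leq_add ?leq_ord.
    by rewrite natrD; field.
  rewrite !alpha_bernstein_meanD !alpha_bernstein_meanZ.
  rewrite !alpha_bernstein_mean_cst //.
  by rewrite alpha_bernstein_mean_id // /P; field.
have JP g : JM1 alpha rho a0 a1 n g x =
    lin_coef a0 a1 x n * P 0%N g + lin_coef a0 a1 (1 - x) n * P 1%N g.
  have -> : P 0%N g = alpha_bernstein_mean alpha m x (E ^~ g).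
    by apply: eq_alpha_bernstein_mean => k; rewrite addn0.
  have -> : P 1%N g = alpha_bernstein_mean alpha m x (fun k => E k.+1 g).
    by apply: eq_alpha_bernstein_mean => k; rewrite addn1.
  exact: JM1E.
rewrite !JP !Pf //.
set A := lin_coef a0 a1 x n; set B := lin_coef a0 a1 (1 - x) n.
have rho0 : rho != 0 by rewrite gt_eqF.
(* The two identities that determine a0 and a1: constants and the function t
   are reproduced. *)
have AB1 : A + B = 1 by rewrite /A /B /lin_coef a0E a1E; field.
have ABx : A * ((m%:R * x + 0%:R) * rho + 1)
    + B * ((m%:R * x + 1%:R) * rho + 1) = s * x.
  by rewrite /A /B /lin_coef a0E a1E /s /n -natr1; field.
have BA : B = 1 - A by rewrite -AB1 addrC addKr.
rewrite BA combine_remainders; last first.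
  rewrite !mulrA -BA.
  by rewrite -mulrDl ABx mulrAC divff // mul1r.
have Pr i : (i <= 1)%N -> `|P i r| <= w * (2 / n%:R * (1 + K)).
  move=> i1; apply: le_trans (ler_norm_alpha_bernstein_mean _ _ _ _) _ => //.
  apply: (@le_trans _ _ (alpha_bernstein_mean alpha m x (fun k =>
     w * (2 / n%:R) + w * (2 * n%:R) * E (k + i)%N (fun t => (t - x) ^+ 4)))).
    apply: alpha_bernstein_mean_le => // k km; have [p0 q0] := pq (k + i)%N.
    rewrite /E /paltanea_mean -beta_meanZ //; last exact: cont01_exprB.
    rewrite -(beta_mean_cst (w * (2 / n%:R)) p0 q0).
    rewrite -beta_meanD //; last exact: cont01_cst.
    apply: ler_norm_beta_mean => //.
      by move=> t; apply: cvgD; [exact: cont01_cst|exact: cl].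
    move=> t t01.
    apply: le_trans (taylor_remainder_le (n := n) hf x01 t01 _) _ => //.
    by rewrite -/w mulrDr mulrA.
  rewrite alpha_bernstein_meanD alpha_bernstein_mean_cst //.
  rewrite alpha_bernstein_meanZ.
  rewrite -mulrA -mulrDr ler_wpM2l // mulrDr mulr1 lerD2l.
  have := composed_moment4_le al01 r0 x01 m0 i1; rewrite -/n -/K => hK.
  apply: le_trans (ler_wpM2l _ hK) _; first by rewrite mulr_ge0.
  have e (u v : R) : u != 0 -> 2 * u * (v / u ^+ 2) = 2 / u * v.
    by move=> u0; field.
  by rewrite e ?gt_eqF.
have hA : `|A| <= (rho + 2) / rho by exact: ler_norm_lin_coef.
have hB : `|1 - A| <= (rho + 2) / rho.
  by rewrite -BA; apply: ler_norm_lin_coef => //; lra.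
have e (b c u v : R) :
    4 * b * (1 + v) * (1 / u) * c = b * (c * (2 / u * (1 + v))) *+ 2 by ring.
(* Generalizing the means keeps their integrals from being unfolded when the
   two sides are compared. *)
rewrite e; move: hA hB (Pr 0%N isT) (Pr 1%N isT).
move: (A) (P 0%N r) (P 1%N r) (_ / rho) (w * _) => a u v b c.
exact: ler_norm_combination.
Qed.

End Paltanea.

Theorem theorem6 (R : realType) (alpha rho : R)
  (halpha : 0 <= alpha <= 1) (hrho : 0 < rho) :
  let a0 : nat -> R := fun _ => (rho + 1) / rho in
  let a1 : nat -> R := fun _ => - ((rho + 2) / rho) in
  exists C : R, 0 < C /\
    forall f : R -> R, C2_01 f ->
    forall x : R, x \in `[0, 1] ->
    forall n : nat, (2 <= n)%N ->
      `| JM1 alpha rho a0 a1 n f x - f x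
         - 1 / 2 * JM1 alpha rho a0 a1 n (fun t => (t - x) ^+ 2) x
           * deriv01 (deriv01 f) x |
      <= C * (1 / n%:R)
         * modulus01 (deriv01 (deriv01 f)) (1 / Num.sqrt n%:R).
Proof.
move=> a0 a1.
exists (4 * ((rho + 2) / rho) * (1 + moment4_const rho / rho ^+ 2)); split.
  have c0 : 0 < (rho + 2) / rho by rewrite divr_gt0 //; lra.
  have K0 : 0 <= moment4_const rho / rho ^+ 2.
    by rewrite divr_ge0 ?sqr_ge0 // moment4_const_ge0.
  by apply: mulr_gt0; [exact: mulr_gt0|exact: ltr_pwDl].
move=> f hf x; rewrite in_itv /= => x01 [|m] // m1.
exact: JM1_voronovskaya_le.
Qed.
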